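(* Assume that $\{B\in\{-1,1\}^{n\times r} : B^\top B=nI_r,\ B^\top v=0\}\neq\emptyset$, and let $f:\mathbb{R}^{n\times r}\to\mathbb{R}$ be continuously differentiable. Consider $$(Q)\quad \min\{f(X) : X\in\mathcal{B}_v(n,r)\cap\Lambda\}.$$ Fix any $\gamma>0$. Suppose that for every global (respectively, local) optimal solution $X^*$ of $(Q)$ there exist $L'>0$ and $\delta'>0$ such that for all $X\in\mathbb{B}(X^*,\delta')\cap\mathcal{B}_v(n,r)$ and all $\overline X\in\mathrm{proj}_{\mathcal{B}_v(n,r)\cap\Lambda}(X)$, $$f(X)-f(\overline X)\ge -L'\|X-\overline X\|_F^2 .$$ Then, for every global (respectively, local) optimal solution $X^*$ of $(Q)$, with $L'$ the corresponding constant, there exists $\varepsilon>0$ such that for all $X\in\mathbb{B}(X^*,\varepsilon)\cap\mathcal{B}_v(n,r)$, $$f(X)-f(X^* )+2L'\gamma(2\sqrt{nr}+1)^2\,\mathrm{env}_{\gamma h_{\frac1{\sqrt n}}}(X)\ge 0,$$ and consequently there exists a threshold $\overline\rho>0$ such that, for each $\rho\ge\overline\rho$, the problem $$\min_{X\in\mathcal{B}_v(n,r)}\ f(X)+\rho\,\mathrm{env}_{\gamma h_{\frac1{\sqrt n}}}(X)$$ has the same global optimal solution set as problem $(Q)$.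
   Context: Let $n,r$ be positive integers and $v\in\mathbb{R}^n$. $\mathcal{B}_v(n,r):=\{X\in\mathbb{R}^{n\times r} : X^\top X=I_r,\ X^\top v=0\}$. $\Lambda:=\{X\in\mathbb{R}^{n\times r} : |X_{ij}|\le\frac1{\sqrt n}\ \forall i,j\}$. $h_{\frac1{\sqrt n}}(X):=\sum_{i,j}\max(0,|X_{ij}|-\tfrac1{\sqrt n})$ is the entrywise $\ell_1$-distance from $X$ to $\Lambda$. For $\gamma>0$, the Moreau envelope is $\mathrm{env}_{\gamma h}(X):=\min_{Z\in\mathbb{R}^{n\times r}}\{\frac1{2\gamma}\|Z-X\|_F^2+h(Z)\}$. $\mathbb{B}(X,\delta)$ is the closed Frobenius-norm ball of radius $\delta$ centred at $X$. $\mathrm{proj}_\Omega(X)$ is the set of Frobenius-nearest points of $\Omega$ to $X$. *)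

(* Defs.v *)
From HB Require Import structures.
From mathcomp Require Export all_boot all_order all_algebra.
From mathcomp Require Export all_classical all_reals all_analysis.

Set Implicit Arguments.
Unset Strict Implicit.
Unset Printing Implicit Defensive.

Import Order.TTheory GRing.Theory Num.Theory.
Import numFieldNormedType.Exports.

Local Open Scope classical_set_scope.
Local Open Scope ring_scope.

Section Defs.
Context {R : realType} {n r : nat}.
Implicit Types (X Y Z : 'M[R]_(n, r)) (F : set 'M[R]_(n, r)).
Implicit Types (f h : 'M[R]_(n, r) -> R) (v : 'cV[R]_n).

(* The library norm on matrices is the max norm, so the Frobenius norm is
   defined here; both induce the topology carried by 'M[R]_(n, r). *)
Definition fnorm X : R := Num.sqrt (\sum_i \sum_j X i j ^+ 2).

Definition fball X (d : R) : set 'M[R]_(n, r) := closed_ball_ fnorm X d.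

Definition proj F X : set 'M[R]_(n, r) :=
  [set Y | F Y /\ forall Z, F Z -> fnorm (X - Y) <= fnorm (X - Z)].

Definition gradient f X : 'M[R]_(n, r) :=
  \matrix_(i, j) 'D_(delta_mx i j) f X.

Definition continuously_differentiable f : Prop :=
  (forall X, differentiable f X) /\ continuous (gradient f).

Definition global_minimizers f F : set 'M[R]_(n, r) :=
  [set X | F X /\ forall Y, F Y -> f X <= f Y].

Definition local_minimizers f F : set 'M[R]_(n, r) :=
  [set X | F X /\ exists2 d : R, 0 < d &
             forall Y, fball X d Y -> F Y -> f X <= f Y].

Definition Bv v : set 'M[R]_(n, r) :=
  [set X : 'M[R]_(n, r) | X^T *m X = 1%:M /\ X^T *m v = 0].

Definition sign_points v : set 'M[R]_(n, r) :=
  [set B : 'M[R]_(n, r) | [/\ forall i j, B i j = -1 \/ B i j = 1,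
               B^T *m B = n%:R%:M & B^T *m v = 0]].

Definition isqrtn : R := (Num.sqrt n%:R)^-1.

Definition Lambda : set 'M[R]_(n, r) :=
  [set X : 'M[R]_(n, r) | forall i j, `|X i j| <= isqrtn].

(* hpen isqrtn X is the entrywise l1-distance from X to Lambda. *)
Definition hpen (t : R) X : R :=
  \sum_i \sum_j Num.max 0 (`|X i j| - t).

(* For gamma > 0 and h = hpen t the infimum is a minimum, the objective being
   continuous, coercive and nonnegative. *)
Definition env (gamma : R) h X : R :=
  inf [set (2 * gamma)^-1 * fnorm (Z - X) ^+ 2 + h Z
      | Z in [set: 'M[R]_(n, r)]].

Definition growth_at f v Xs (L' d' : R) : Prop :=
  forall X, fball Xs d' X -> Bv v X ->
  forall Xbar, proj (Bv v `&` Lambda) X Xbar ->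
    f X - f Xbar >= - L' * fnorm (X - Xbar) ^+ 2.

End Defs.

Arguments isqrtn : clear implicits.

(* Main.v *)
(* A feasible point has all entries equal to +-1/sqrt n, so the feasible set F is
   discrete and an optimal Xs is the projection onto F of every X near it. Since X
   in Bv and Xs have the same Frobenius norm, |X - Xs|_F is at most
   2 sqrt(n r) + 1 times the distance of X to Lambda, whose square is at most
   2 gamma env(X) near Xs; with the growth hypothesis this is the local
   inequality. The threshold comes from compactness of Bv: every X in Bv has a
   neighbourhood on which f + rho env stays above the optimal value for all large
   rho, by the local inequality (X optimal), by continuity of f (X feasible but not
   optimal), or because env is bounded away from 0 (X outside Lambda). *)
Require Import Defs.
From mathcomp Require Import ring lra.
Import Order.TTheory GRing.Theory Num.Theory.
Import numFieldNormedType.Exports.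
Local Open Scope classical_set_scope.
Local Open Scope ring_scope.

(** * Inequalities for finite sums, and the error bound on a sphere *)

Section FiniteSums.
Context {R : realType} {I : finType}.
Implicit Types p x y : I -> R.

(** Cauchy-Schwarz against the constant vector, obtained by expanding the nonnegative sum of squared
    deviations of [N * p i] from the total [t]. *)
Lemma sqr_sum_le_card p :
  (\sum_i p i) ^+ 2 <= #|I|%:R * \sum_i p i ^+ 2.
Proof.
have [I0|I_gt0] := posnP #|I|.
  rewrite !big_pred0 ?expr0n ?mulr0 // => i; exact: (card0_eq I0 i).
set N : R := #|I|%:R; set t := \sum_i p i.
have N_gt0 : 0 < N by rewrite ltr0n.
have : 0 <= \sum_i (N * p i - t) ^+ 2 by apply: sumr_ge0 => i _; exact: sqr_ge0.
have -> : \sum_i (N * p i - t) ^+ 2 = N * (N * \sum_i p i ^+ 2 - t ^+ 2).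
  transitivity (\sum_i (N ^+ 2 * p i ^+ 2 + (- (2 * N * t) * p i + t ^+ 2))).
    by apply: eq_bigr => i _; ring.
  rewrite !big_split /= -!mulr_sumr -/t sumr_const -mulr_natl cardT -cardE -/N.
  by ring.
by rewrite pmulr_rge0 // subr_ge0.
Qed.

Lemma sum_sqr_le_sqr_sum p : (forall i, 0 <= p i) ->
  \sum_i p i ^+ 2 <= (\sum_i p i) ^+ 2.
Proof.
move=> p0; rewrite [leRHS]expr2 mulr_suml; apply: ler_sum => i _.
rewrite expr2 ler_wpM2l // (bigD1 i) //= lerDl; exact: sumr_ge0.
Qed.

(* Put e i = y i (x i - y i) / s. Then |x i - y i| = |e i| <= 2 p i - e i with
   p i = max(0, |x i| - s), while the equality of the norms gives
   sum e = - sum (x - y)^2 / (2 s), which is of second order. *)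
Lemma sphere_error_bound (s : R) x y :
    let K := 2 * Num.sqrt #|I|%:R + 1 in
    0 < s -> (forall i, `|y i| = s) -> \sum_i x i ^+ 2 = \sum_i y i ^+ 2 ->
    (forall i, `|x i - y i| * K <= 2 * s) ->
  \sum_i (x i - y i) ^+ 2 <= K ^+ 2 * \sum_i Num.max 0 (`|x i| - s) ^+ 2.
Proof.
move=> K s_gt0 ys xy xyK.
have [I0|I_gt0] := posnP #|I|.
  rewrite !big_pred0 ?mulr0 // => i; exact: (card0_eq I0 i).
set w := Num.sqrt #|I|%:R in K xyK *.
have w_gt0 : 0 < w by rewrite sqrtr_gt0 ltr0n.
have K_gt0 : 0 < K by rewrite /K; lra.
set p := fun i => Num.max 0 (`|x i| - s); set d := fun i => x i - y i.
have p_ge0 i : 0 <= p i by rewrite /p le_max lexx.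
pose e i := y i * d i / s.
have y2 i : y i * y i = s ^+ 2 by rewrite -(ys i) real_normK ?num_real // expr2.
have ne i : `|e i| = `|d i|.
  by rewrite /e !normrM ys normfV (gtr0_norm s_gt0) mulrAC divff ?mul1r // gt_eqF.
(* Since [y i ^+ 2 = s ^+ 2], the sum [e i + s] is [y i * x i / s], which is at most [|x i|]. *)
have ep i : e i <= p i.
  rewrite /p le_max; apply/orP; right.
  have : s * (e i + s) <= s * `|x i|.
    have -> : s * (e i + s) = y i * x i.
      rewrite /e /d mulrDr mulrCA divff ?gt_eqF // mulr1 mulrBr y2; ring.
    by rewrite -{1}(ys i) -normrM ler_norm.
  by rewrite ler_pM2l // => ?; lra.
have dp i : `|d i| <= 2 * p i - e i.
  rewrite -ne; case: (ger0P (e i)) (ep i) (p_ge0 i) => _; lra.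
have sum_e : \sum_i e i = - (\sum_i d i ^+ 2) / (2 * s).
  rewrite /e -mulr_suml.
  have -> : \sum_i y i * d i = - (\sum_i d i ^+ 2) / 2.
    suff : \sum_i (2 * (y i * d i) + d i ^+ 2) = 0.
      by rewrite big_split /= -mulr_sumr => ?; lra.
    transitivity (\sum_i x i ^+ 2 - \sum_i y i ^+ 2); last by rewrite xy subrr.
    by rewrite -sumrB; apply: eq_bigr => i _; rewrite /d; ring.
  by field; rewrite gt_eqF.
set D := \sum_i `|d i|; set P := \sum_i p i.
have D_ge0 : 0 <= D by apply: sumr_ge0.
have P_ge0 : 0 <= P by apply: sumr_ge0.
(* The smallness hypothesis [xyK] bounds the second-order term [(\sum_i d i ^+ 2) / (2 * s)] by
   [D / K]. *)
have d2D : K * (\sum_i d i ^+ 2) <= 2 * s * D.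
  rewrite !mulr_sumr; apply: ler_sum => i _.
  rewrite -[d i ^+ 2]real_normK ?num_real // expr2 mulrA ler_wpM2r //.
  by rewrite mulrC xyK.
have DP : K * D <= 2 * K * P + D.
  have : D <= 2 * P - \sum_i e i.
    by rewrite /P mulr_sumr -sumrB; apply: ler_sum => i _; exact: dp.
  rewrite sum_e mulNr opprK => DP.
  have := ler_wpM2l (ltW K_gt0) DP; move=> /le_trans; apply.
  rewrite mulrDr [K * (2 * P)]mulrCA -mulrA lerD2l.
  by rewrite mulrA ler_pdivrMr ?mulr_gt0 // mulrC (mulrC D) in d2D *.
(* Absorbing [D] into the left side of [DP] leaves the factor [K - 1 = 2 * w]; this explains the
   value of [K]. *)
have DKP : w * D <= K * P by move: DP; rewrite {1}/K; lra.
have P2 : P ^+ 2 <= w ^+ 2 * \sum_i p i ^+ 2.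
  by rewrite /w sqr_sqrtr ?ler0n //; exact: sqr_sum_le_card.
have d2 : \sum_i d i ^+ 2 <= D ^+ 2.
  rewrite (eq_bigr (fun i => `|d i| ^+ 2)) => [|i _]; last first.
    by rewrite real_normK ?num_real.
  by apply: sum_sqr_le_sqr_sum => i.
(* The factor [w ^+ 2] that Cauchy-Schwarz puts in [P2] matches the one in front of [D ^+ 2], so it
   cancels and only [K ^+ 2] remains. *)
have : w ^+ 2 * D ^+ 2 <= w ^+ 2 * (K ^+ 2 * \sum_i p i ^+ 2).
  apply: (@le_trans _ _ (K ^+ 2 * P ^+ 2)).
    by rewrite -!exprMn lerXn2r // nnegrE mulr_ge0 // ltW.
  by rewrite [leRHS]mulrCA; apply: ler_wpM2l => //; exact: sqr_ge0.
by rewrite ler_pM2l ?exprn_gt0 // => /(le_trans d2).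
Qed.

End FiniteSums.

(** * The Frobenius norm and bounds on the Moreau envelope *)

Section Envelope.
Context {R : realType} {n r : nat}.
Implicit Types X Y Z : 'M[R]_(n, r).

Lemma sqr_fnorm X : fnorm X ^+ 2 = \sum_i \sum_j X i j ^+ 2.
Proof.
by rewrite sqr_sqrtr //; do 2 (apply: sumr_ge0 => ? _); exact: sqr_ge0.
Qed.

Lemma fnorm_ge0 X : 0 <= fnorm X.
Proof. exact: sqrtr_ge0. Qed.

Lemma normr_le_fnorm X i j : `|X i j| <= fnorm X.
Proof.
rewrite -(@ler_pXn2r _ 2) ?nnegrE ?fnorm_ge0 // sqr_fnorm real_normK ?num_real //.
rewrite (bigD1 i) //= (bigD1 j) //= -addrA lerDl.
apply: addr_ge0; first by apply: sumr_ge0 => ? _; exact: sqr_ge0.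
by do 2 (apply: sumr_ge0 => ? _); exact: sqr_ge0.
Qed.

Lemma fnorm_le_sum X : fnorm X <= \sum_i \sum_j `|X i j|.
Proof.
have s0 : 0 <= \sum_i \sum_j `|X i j| by do 2 (apply: sumr_ge0 => ? _).
rewrite -(@ler_pXn2r _ 2) ?nnegrE ?fnorm_ge0 // sqr_fnorm !pair_bigA /=.
rewrite (eq_bigr (fun p : 'I_n * 'I_r => `|X p.1 p.2| ^+ 2)) => [|p _]; last first.
  by rewrite real_normK ?num_real.
exact: sum_sqr_le_sqr_sum.
Qed.

Lemma env_objective_ge0 (g s : R) X Z : 0 < g ->
  0 <= (2 * g)^-1 * fnorm (Z - X) ^+ 2 + hpen s Z.
Proof.
move=> g0; apply: addr_ge0.
  by rewrite mulr_ge0 ?sqr_ge0 // invr_ge0 mulr_ge0 // ltW.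
by do 2 (apply: sumr_ge0 => ? _); rewrite le_max lexx.
Qed.

(* The scalar inequality (z - x)^2 + 2 g a >= q^2, with a = max(0, |z| - s)
   and q = min(g, max(0, |x| - s)), holds because |z - x| >= q - a. *)
Lemma env_ge (g s : R) X : 0 < g ->
  (2 * g)^-1 * \sum_i \sum_j Num.min g (Num.max 0 (`|X i j| - s)) ^+ 2
  <= env g (hpen s) X.
Proof.
move=> g0; apply: lb_le_inf.
  by exists ((2 * g)^-1 * fnorm (X - X) ^+ 2 + hpen s X); exists X.
have g2 : 0 < 2 * g by rewrite mulr_gt0.
move=> _ [Z _ <-]; rewrite ler_pdivrMl // mulrDr mulrA divff ?gt_eqF // mul1r.
rewrite sqr_fnorm /hpen mulr_sumr -big_split; apply: ler_sum => i _ /=.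
rewrite mulr_sumr -big_split; apply: ler_sum => j _ /=; rewrite !mxE.
move: (X i j) (Z i j) => x z.
set q := Num.min _ _; set a := Num.max _ _.
have q_ge0 : 0 <= q by rewrite le_min (ltW g0) le_max lexx.
have qg : q <= g by rewrite ge_min lexx.
have a_ge0 : 0 <= a by rewrite le_max lexx.
have qa : q - a <= `|z - x|.
  have az : `|z| - s <= a by rewrite le_max lexx orbT.
  have qx : q <= Num.max 0 (`|x| - s) by rewrite ge_min lexx orbT.
  have := ler_distD z x 0; rewrite !subr0 distrC => xz.
  move: qx; rewrite le_max => /orP[] ?; have := normr_ge0 (z - x); lra.
rewrite -[(z - x) ^+ 2]real_normK ?num_real //.
move: `|z - x| (normr_ge0 (z - x)) qa => t t0 qa.
(* If [a <= q], then [(q - a) ^+ 2 + 2 * g * a >= q ^+ 2] because [q <= g]; if [a > q], the term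
   [2 * g * a] alone exceeds [q ^+ 2]. *)
have [aq|qa'] := leP a q; nra.
Qed.

Lemma env_ge0 (g s : R) X : 0 < g -> 0 <= env g (hpen s) X.
Proof.
move=> g0; apply: lb_le_inf.
  by exists ((2 * g)^-1 * fnorm (X - X) ^+ 2 + hpen s X); exists X.
by move=> _ [Z _ <-]; exact: env_objective_ge0.
Qed.

(** The choice [Z = X] makes both terms of the objective vanish. *)
Lemma env_Lambda (g : R) X : 0 < g -> Lambda X ->
  env g (hpen (isqrtn R n)) X = 0.
Proof.
move=> g0 XL; apply/eqP; rewrite eq_le env_ge0 // andbT.
have -> : 0 = (2 * g)^-1 * fnorm (X - X) ^+ 2 + hpen (isqrtn R n) X.
  rewrite subrr sqr_fnorm big1 => [|i _]; last first.
    by apply: big1 => j _; rewrite mxE expr0n.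
  rewrite mulr0 add0r /hpen big1 // => i _; apply: big1 => j _.
  by apply/max_idPl; rewrite subr_le0; exact: XL.
apply: ge_inf; last by exists X.
by exists 0 => _ [Z _ <-]; exact: env_objective_ge0.
Qed.

(** Keeps a single term of [env_ge]. One entry beyond the bound thus makes the envelope positive,
    and uniformly so near the point. *)
Lemma env_ge_entry (g s : R) X i j : 0 < g ->
  (2 * g)^-1 * Num.min g (Num.max 0 (`|X i j| - s)) ^+ 2 <= env g (hpen s) X.
Proof.
move=> g0; apply: (le_trans _ (env_ge g s X g0)).
apply: ler_wpM2l; first by rewrite invr_ge0 mulr_ge0 // ltW.
rewrite (bigD1 i) //= (bigD1 j) //= -addrA lerDl.
apply: addr_ge0; first by apply: sumr_ge0 => ? _; exact: sqr_ge0.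
by do 2 (apply: sumr_ge0 => ? _); exact: sqr_ge0.
Qed.

Lemma env_eq0_Lambda (g : R) X : 0 < g ->
  env g (hpen (isqrtn R n)) X <= 0 -> Lambda X.
Proof.
move=> g0 eX i j; rewrite leNgt; apply/negP => sX.
have := le_trans (env_ge_entry g (isqrtn R n) X i j g0) eX.
rewrite leNgt => /negP; apply.
apply: mulr_gt0; first by rewrite invr_gt0 mulr_gt0.
rewrite exprn_gt0 // lt_min g0 lt_max.
by rewrite subr_gt0 sX orbT.
Qed.

End Envelope.

(** * Feasible points and their projections *)

Section Stiefel.
Context {R : realType} {n r : nat}.
Implicit Types (X Y Z : 'M[R]_(n, r)) (v : 'cV[R]_n).

Lemma isqrtn_gt0 : (0 < n)%N -> 0 < isqrtn R n.
Proof. by move=> n0; rewrite invr_gt0 sqrtr_gt0 ltr0n. Qed.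

Lemma sqr_isqrtn : isqrtn R n ^+ 2 = n%:R^-1.
Proof. by rewrite exprVn sqr_sqrtr ?ler0n. Qed.

(** The sum is the trace of [X^T *m X]. It puts [Bv v] on one Frobenius sphere, as
    [sphere_error_bound] requires. *)
Lemma Bv_sum_sqr v X : Bv v X -> \sum_i \sum_j X i j ^+ 2 = r%:R.
Proof.
move=> [XX _]; rewrite exchange_big /=.
rewrite (eq_bigr (fun=> 1)) => [|j _]; first by rewrite sumr_const card_ord.
transitivity ((X^T *m X) j j); last by rewrite XX mxE eqxx.
by rewrite mxE; apply: eq_bigr => i _; rewrite mxE expr2.
Qed.

(* A feasible X has n r entries, each at most 1/sqrt n in absolute value, whose
   squares add up to r: all the bounds are attained. *)
Lemma feasible_entry v X i j : (0 < n)%N ->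
  Bv v X -> Lambda X -> `|X i j| = isqrtn R n.
Proof.
move=> n0 BX LX.
have s0 := isqrtn_gt0 n0.
have sX k l : 0 <= isqrtn R n ^+ 2 - X k l ^+ 2.
  rewrite subr_ge0 -[X k l ^+ 2]real_normK ?num_real //.
  by rewrite lerXn2r ?nnegrE ?LX // ltW.
have : \sum_k \sum_l (isqrtn R n ^+ 2 - X k l ^+ 2) == 0.
  under eq_bigr do rewrite sumrB sumr_const card_ord.
  rewrite sumrB (Bv_sum_sqr _ _ BX) sumr_const card_ord sqr_isqrtn.
  by rewrite mulrnAC -(mulr_natr n%:R^-1 n) mulVf ?pnatr_eq0 -?lt0n // subrr.
rewrite psumr_eq0 => [|k _]; last by apply: sumr_ge0.
move=> /allP/(_ i (mem_index_enum _)) /=.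
rewrite psumr_eq0 // => /allP/(_ j (mem_index_enum _)) /=.
rewrite subr_eq0 eq_sym -[X i j ^+ 2]real_normK ?num_real //.
by rewrite eqrXn2 // ?ltW // => /eqP.
Qed.

Lemma sign_point_feasible v (B : 'M[R]_(n, r)) : (0 < n)%N -> sign_points v B ->
  (Bv v `&` Lambda) (isqrtn R n *: B).
Proof.
move=> n0 [Bs BB Bv0]; split; first split.
- rewrite [(_ *: B)^T]linearZ /= -scalemxAl -scalemxAr BB scalerA -expr2 sqr_isqrtn.
  by rewrite scale_scalar_mx mulVf // pnatr_eq0 -lt0n.
- by rewrite [(_ *: B)^T]linearZ /= -scalemxAl Bv0 scaler0.
- move=> i j; rewrite mxE normrM (gtr0_norm (isqrtn_gt0 n0)).
  by case: (Bs i j) => ->; rewrite ?normrN normr1 mulr1.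
Qed.

(** Two distinct feasible points have opposite signs in some entry, hence differ there by twice
    [isqrtn R n]; the triangle inequality in that entry keeps [Z] at least [isqrtn R n] away from
    [X]. *)
Lemma proj_near v X Xs : (0 < n)%N -> (Bv v `&` Lambda) Xs ->
  fnorm (X - Xs) <= isqrtn R n -> proj (Bv v `&` Lambda) X Xs.
Proof.
move=> n0 [BXs LXs] XXs; split=> // Z [BZ LZ].
have [->//|/eqP ZXs] := eqVneq Z Xs.
have [i [j Zij]] : exists i j, Z i j != Xs i j.
  apply: contrapT => h; apply: ZXs; apply/matrixP => i j.
  by apply/eqP/negPn/negP => Zij; apply: h; exists i, j.
have := normr_le_fnorm (X - Z) i j; have := normr_le_fnorm (X - Xs) i j.
have := feasible_entry v Z i j n0 BZ LZ; have := feasible_entry v Xs i j n0 BXs LXs.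
rewrite !mxE; move: Zij XXs (isqrtn_gt0 n0); set s := isqrtn R n.
move: (fnorm _) (fnorm _) (X i j) (Z i j) (Xs i j) => a b x z y.
case: (ger0P y) => _; case: (ger0P z) => _ zy; case: (ger0P (x - y)) => ?;
case: (ger0P (x - z)) => *; try lra; exfalso; move/eqP: zy; apply; lra.
Qed.

(** * Topology: neighbourhoods, closedness, compactness, existence of minimizers *)

Lemma fball_nbhs X (e : R) : 0 < e -> nbhs X (fball X e).
Proof.
move=> e0; apply/nbhs_ballP; set N : R := (n * r)%:R.
have N1 : 0 < N + 1 by rewrite ltr_wpDl ?ler0n.
(* The [N] entries then add up to at most [e]; dividing by [N + 1] also covers matrices without
   entries. *)
exists (e / (N + 1)); first exact: divr_gt0.
move=> Y [_ XY]; rewrite /fball /closed_ball_ /=.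
apply: le_trans (fnorm_le_sum _) _.
apply: (@le_trans _ _ (\sum_(i < n) \sum_(j < r) (e / (N + 1)))).
  by do 2 (apply: ler_sum => ? _); rewrite !mxE ltW //; exact: XY.
rewrite !sumr_const !card_ord -mulrnA -mulr_natr mulnC -/N.
by rewrite mulrAC ler_pdivrMr // ler_pM2l // lerDl.
Qed.

Lemma continuous_gram_entry k l : continuous (fun X => (X^T *m X) k l).
Proof.
rewrite (_ : (fun _ => _) = (fun X => \sum_i X i k * X i l)); last first.
  by apply/funext => X; rewrite mxE; apply: eq_bigr => i _; rewrite mxE.
apply: continuous_big => [x|i _]; first exact: add_continuous.
by move=> X; apply: continuousM; exact: coord_continuous.
Qed.

Lemma continuous_trmx_mul_entry v k l : continuous (fun X => (X^T *m v) k l).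
Proof.
rewrite (_ : (fun _ => _) = (fun X => \sum_i X i k * v i l)); last first.
  by apply/funext => X; rewrite mxE; apply: eq_bigr => i _; rewrite mxE.
apply: continuous_big => [x|i _]; first exact: add_continuous.
by move=> X; apply: continuousM; [exact: coord_continuous|exact: cst_continuous].
Qed.

Lemma closed_Bv v : closed (Bv v : set 'M[R]_(n, r)).
Proof.
have -> : Bv v =
    \bigcap_(p in [set: 'I_r * 'I_r])
       (fun X => (X^T *m X) p.1 p.2) @^-1` [set x | x = 1%:M p.1 p.2] `&`
    \bigcap_(p in [set: 'I_r * 'I_1])
       (fun X => (X^T *m v) p.1 p.2) @^-1` [set x | x = 0].
  apply/seteqP; split=> X [XX Xv].
    by split=> p _ /=; rewrite ?XX ?Xv ?mxE.
  split; apply/matrixP => i j; first exact: (XX (i, j)).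
  by rewrite [RHS]mxE; exact: (Xv (i, j)).
apply: closedI; apply: closed_bigI => p _.
- have /continuous_closedP := continuous_gram_entry p.1 p.2.
  by apply; exact: closed_eq.
- have /continuous_closedP := continuous_trmx_mul_entry v p.1 p.2.
  by apply; exact: closed_eq.
Qed.

Lemma closed_Lambda : closed (Lambda : set 'M[R]_(n, r)).
Proof.
have -> : Lambda =
    \bigcap_(p in [set: 'I_n * 'I_r])
       (fun X => `|X p.1 p.2|) @^-1` [set x | x <= isqrtn R n].
  apply/seteqP; split=> X XL; first by move=> p _; exact: XL.
  by move=> i j; exact: (XL (i, j)).
apply: closed_bigI => p _.
have /continuous_closedP : continuous (fun X => `|X p.1 p.2|).
  move=> X.
  apply: (@continuous_comp _ _ _ (fun Y : 'M[R]_(n, r) => Y p.1 p.2) Num.norm).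
    exact: coord_continuous.
  exact: norm_continuous.
by apply; exact: closed_le.
Qed.

Lemma vec_mx_continuous : continuous (@vec_mx R n r).
Proof.
move=> u A /nbhs_ballP[e e0 eA]; apply/nbhs_ballP; exists e => // w [_ uw].
by apply: eA; split=> // i j; rewrite !mxE; exact: uw.
Qed.

(** The columns are unit vectors, so [Bv v] is a closed subset of the image under [vec_mx] of the
    compact box of row vectors with entries in [-1, 1]. *)
Lemma compact_Bv v : compact (Bv v : set 'M[R]_(n, r)).
Proof.
pose box := [set u : 'rV[R]_(n * r) | forall k, `[(-1 : R), 1]%classic (u ord0 k)].
apply: (@subclosed_compact _ _ (vec_mx @` box)).
- exact: closed_Bv.
- apply: continuous_compact.
    by apply: continuous_subspaceT; exact: vec_mx_continuous.
  by apply: (@rV_compact R _ (fun=> `[(-1 : R), 1]%classic)) => k; exact: segment_compact.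
- move=> X BX; exists (mxvec X); last exact: mxvecK.
  move=> k; case/mxvec_indexP: k => i j; rewrite mxvecE /= in_itv /= -ler_norml.
  have [XX _] := BX.
  have : X i j ^+ 2 <= 1.
    rewrite -[leRHS](_ : (X^T *m X) j j = 1); last by rewrite XX mxE eqxx.
    rewrite mxE (bigD1 i) //= mxE -expr2 lerDl.
    by apply: sumr_ge0 => k _; rewrite mxE -expr2 sqr_ge0.
  by rewrite -[X i j ^+ 2]real_normK ?num_real // expr_le1.
Qed.

Lemma global_minimizer_exists (f : 'M[R]_(n, r) -> R) v : continuous f ->
  (Bv v `&` Lambda : set 'M[R]_(n, r)) !=set0 ->
  global_minimizers f (Bv v `&` Lambda) !=set0.
Proof.
move=> fc F0.
have Fc : compact (Bv v `&` Lambda : set 'M[R]_(n, r)).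
  by apply: compact_closedI; [exact: compact_Bv|exact: closed_Lambda].
have [X XF Xmin] := compact_EVT_min F0 Fc (continuous_subspaceT fc).
by exists X; split=> [|Y FY]; [exact: set_mem|apply: Xmin; exact: mem_set].
Qed.

End Stiefel.

(** * Local inequality and global threshold for the penalty *)

Section ExactPenalty.
Context {R : realType} {n r : nat}.
Hypothesis n0 : (0 < n)%N.
Variables (v : 'cV[R]_n) (f : 'M[R]_(n, r) -> R) (g : R).
Hypothesis g0 : 0 < g.
Implicit Types X Y : 'M[R]_(n, r).

Local Notation F := (Bv v `&` Lambda : set 'M[R]_(n, r)).
Local Notation penalty X := (env g (hpen (isqrtn R n)) X).
Local Notation K := (2 * Num.sqrt (n * r)%:R + 1 : R).

Lemma local_exact_penalty Xs (L d : R) : F Xs -> 0 < L -> 0 < d ->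
  growth_at f v Xs L d ->
  exists2 e : R, 0 < e & forall X, fball Xs e X -> Bv v X ->
    0 <= f X - f Xs + 2 * L * g * K ^+ 2 * penalty X.
Proof.
move=> FXs L0 d0 growth; have [BXs LXs] := FXs.
set s := isqrtn R n; have s0 : 0 < s := isqrtn_gt0 n0.
have K1 : 1 <= K by rewrite lerDr mulr_ge0 // sqrtr_ge0.
have K0 : 0 < K := lt_le_trans ltr01 K1.
(* The bound [d] is for the growth hypothesis, [g] keeps the minimum in [env_ge] untruncated, and
   [s / K] serves [sphere_error_bound] and, as [K >= 1], also [proj_near]. *)
pose e := Num.min d (Num.min g (s / K)).
have [ed [eg esK]] : e <= d /\ e <= g /\ e <= s / K.
  by rewrite /e !ge_min !lexx ?orbT.
have es : e <= s by rewrite (le_trans esK) // ler_pdivrMr // ler_peMr // ltW.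
exists e; first by rewrite !lt_min d0 g0 divr_gt0.
move=> X XXs BX.
have XsX : fnorm (X - Xs) <= e.
  move: XXs; rewrite /fball /closed_ball_ /=; congr (_ <= _).
  rewrite /fnorm; congr Num.sqrt; do 2 (apply: eq_bigr => ? _).
  by rewrite !mxE -sqrrN opprB.
have dX i j : `|X i j - Xs i j| <= e.
  by have := normr_le_fnorm (X - Xs) i j; rewrite !mxE => /le_trans; apply.
have absXs i j : `|Xs i j| = s by exact: (feasible_entry v).
have := growth X _ BX Xs _.
have XXd : fball Xs d X.
  by move: XXs; rewrite /fball /closed_ball_ /= => /le_trans; apply.
move=> /(_ XXd (proj_near _ _ _ n0 FXs (le_trans XsX es))).
have bound : fnorm (X - Xs) ^+ 2 <=
    K ^+ 2 * \sum_i \sum_j Num.max 0 (`|X i j| - s) ^+ 2.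
  have := @sphere_error_bound R ('I_n * 'I_r)%type s
    (fun p => X p.1 p.2) (fun p => Xs p.1 p.2) s0.
  rewrite card_prod !card_ord /= => sph.
  rewrite sqr_fnorm !pair_bigA /=.
  under eq_bigr do rewrite !mxE.
  apply: sph => [p|| p].
  - exact: absXs.
  - rewrite -(pair_bigA _ (fun i j => X i j ^+ 2)).
    by rewrite -(pair_bigA _ (fun i j => Xs i j ^+ 2)) /= !(Bv_sum_sqr v).
  - rewrite -ler_pdivlMr //; apply: le_trans (dX _ _) _.
    by apply: (le_trans esK); rewrite -mulrA; have := divr_gt0 s0 K0; lra.
have envX : \sum_i \sum_j Num.max 0 (`|X i j| - s) ^+ 2 <= 2 * g * penalty X.
  have := env_ge g s X g0; rewrite ler_pdivrMl ?mulr_gt0 //.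
  under eq_bigr => i _.
    under eq_bigr => j _.
      have -> : Num.min g (Num.max 0 (`|X i j| - s)) = Num.max 0 (`|X i j| - s).
        (* The excess [|X i j| - s] is at most [|X i j - Xs i j|], hence at most [e <= g]. *)
        apply/min_idPr; rewrite ge_max ltW //=.
        rewrite -(absXs i j); apply: le_trans (lerB_dist _ _) _.
        exact: le_trans (dX i j) eg.
      over.
    over.
  by [].
move: (penalty X) envX (fnorm (X - Xs) ^+ 2) bound => pen envX dist bound.
have := le_trans bound (ler_wpM2l (sqr_ge0 K) envX).
move: (K ^+ 2) => K2 /(ler_wpM2l (ltW L0)); lra.
Qed.

Lemma near_penalty_ge (m : R) X : {for X, continuous f} -> ~ Lambda X ->
  \forall Y \near X & rho \near +oo, m <= f Y + rho * penalty Y.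
Proof.
move=> fX LX.
have [i [j Xij]] : exists i j, isqrtn R n < `|X i j|.
  apply: contrapT => h; apply: LX => i j; rewrite leNgt; apply/negP => Xij.
  by apply: h; exists i, j.
set s := isqrtn R n in Xij *.
(* By continuity the entry stays above this midpoint near [X], so the envelope stays above the
   constant [c] below. *)
pose b := (`|X i j| + s) / 2.
have b_gt : s < b by rewrite /b; lra.
have b_lt : b < `|X i j| by rewrite /b; lra.
pose c := (2 * g)^-1 * Num.min g (b - s) ^+ 2.
have q0 : 0 < Num.min g (b - s) by rewrite lt_min g0 subr_gt0.
have c0 : 0 < c by rewrite mulr_gt0 ?invr_gt0 ?mulr_gt0 // exprn_gt0.
have nearf : \forall Y \near X, f X - 1 < f Y.
  by apply: (cvgr_gt _ fX); rewrite ltrBlDr ltrDl.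
have nearb : \forall Y \near X, b < `|(Y : 'M[R]_(n, r)) i j|.
  by apply: (@cvgr_norm_gt _ _ _ _ _ (fun Y : 'M[R]_(n, r) => Y i j) _
                 (@coord_continuous R n r i j X)).
(* Then [rho * c >= m - f X + 1], which compensates for [f Y > f X - 1]; the maximum with 0 lets
   [rho] multiply inequalities. *)
pose rho0 := Num.max 0 ((m - f X + 1) / c).
have near_rho : \forall rho \near +oo, rho0 <= rho.
  exact: nbhs_pinfty_ge (num_real _).
exists ([set Y : 'M[R]_(n, r) | f X - 1 < f Y /\ b < `|Y i j|], [set rho | rho0 <= rho]).
  by split=> //; exact: filterI nearf nearb.
move=> [Y rho] [/= [fY bY] ].
rewrite /rho0 ge_max ler_pdivrMr // => /andP[rho_ge0 rhoc].
have cY : c <= penalty Y.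
  apply: (le_trans _ (env_ge_entry g s Y i j g0)).
  apply: ler_wpM2l; first by rewrite invr_ge0 mulr_ge0 // ltW.
  rewrite lerXn2r ?nnegrE //; first exact: ltW.
    by rewrite le_min (ltW g0) le_max lexx.
  rewrite le_min ge_min lexx /= ge_min; apply/orP; right.
  by rewrite le_max lerD2r (ltW bY) orbT.
have := ler_wpM2l rho_ge0 cY; lra.
Qed.

Lemma global_penalty_bound Xm :
    continuous f -> global_minimizers f F Xm ->
    (forall Xs, global_minimizers f F Xs ->
     exists L d : R, [/\ 0 < L, 0 < d & growth_at f v Xs L d]) ->
  \forall rho \near +oo, forall X, Bv v X -> f Xm <= f X + rho * penalty X.
Proof.
move=> fc [FXm Xmin] growth.
(* Compactness in near-covering form: a bound valid jointly for [Y] near each [X] and [rho] large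
   yields one threshold on [rho] for all of [Bv v]. *)
have cover : near_covering_within (Bv v : set 'M[R]_(n, r)).
  by apply/near_covering_withinP/compact_near_coveringP; exact: compact_Bv.
apply: (cover R (pinfty_nbhs R)
  (fun rho Y => f Xm <= f Y + rho * penalty Y)) => X BX.
have [LX|nLX] := pselect (Lambda X); last first.
  have := near_penalty_ge (f Xm) X (fc X) nLX.
  by apply: filterS => -[Y rho] /= ? _.
have [XmX|XXm] := ltP (f Xm) (f X).
  have nearf : \forall Y \near X, f Xm < f Y by exact: (cvgr_gt _ (fc X)).
  have near_rho : \forall rho \near +oo, 0 <= rho :> R.
    exact: nbhs_pinfty_ge (num_real _).
  exists ([set Y | f Xm < f Y], [set rho : R | 0 <= rho]) => //.
  move=> [Y rho] [/= fY rho_ge0] _; rewrite (le_trans (ltW fY)) // lerDl.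
  by rewrite mulr_ge0 // env_ge0.
(* In this last case [X] is feasible with [f X <= f Xm], so the growth hypothesis is available at
   [X] itself. *)
have Xglob : global_minimizers f F X.
  by split=> // Y FY; rewrite (le_trans XXm) // Xmin.
have [L [d [L0 d0 LdX]]] := growth X Xglob.
have [e e0 eX] := local_exact_penalty X L d (conj BX LX) L0 d0 LdX.
set rho0 := 2 * L * g * K ^+ 2 in eX.
have near_rho : \forall rho \near +oo, rho0 <= rho.
  exact: nbhs_pinfty_ge (num_real _).
exists (fball X e, [set rho | rho0 <= rho]).
  by split=> //; exact: fball_nbhs.
move=> [Y rho] [/= XY rho0_le] BY.
have := eX Y XY BY; have := Xmin X (conj BX LX).
have := ler_wpM2r (env_ge0 g (isqrtn R n) Y g0) rho0_le; lra.
Qed.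

Lemma global_exact_penalty :
    continuous f -> F !=set0 ->
    (forall Xs, global_minimizers f F Xs ->
     exists L d : R, [/\ 0 < L, 0 < d & growth_at f v Xs L d]) ->
  exists2 rhobar : R, 0 < rhobar & forall rho, rhobar <= rho ->
    global_minimizers (fun X => f X + rho * penalty X) (Bv v)
    = global_minimizers f F.
Proof.
move=> fc F0 growth.
have [Xm Xglob] := global_minimizer_exists f v fc F0.
have [[BXm LXm] Xmin] := Xglob.
have [M [_ Mbound]] := global_penalty_bound Xm fc Xglob growth.
(* [Mbound] holds strictly above [M], hence the added 1. *)
pose rho1 := Num.max 0 M + 1.
have rho1_gt0 : 0 < rho1 by rewrite ltr_wpDl // le_max lexx.
have rho1_bound : forall X, Bv v X -> f Xm <= f X + rho1 * penalty X.
  by apply: Mbound; rewrite /rho1 ltr_pwDr // le_max lexx orbT.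
(* At a penalized minimizer [X], [f X + rho * penalty X <= f Xm <= f X + rho1 * penalty X]; the gap
   [rho - rho1 >= 1] then forces [penalty X] to vanish, so [X] lies in [Lambda]. *)
exists (rho1 + 1) => [|rho rho_ge]; first exact: addr_gt0.
have pen0 X : 0 <= penalty X by exact: env_ge0.
have penF X : Lambda X -> penalty X = 0 by exact: env_Lambda.
apply/seteqP; split=> X [].
- move=> BX Xopt; have := Xopt Xm BXm; rewrite (penF _ LXm) mulr0 addr0 => XXm.
  have pX : penalty X <= 0.
    have := rho1_bound X BX; have := pen0 X.
    by have := ler_wpM2r (pen0 X) rho_ge; lra.
  have LX : Lambda X := env_eq0_Lambda g X g0 pX.
  split=> // Y FY; move: XXm; rewrite penF // mulr0 addr0 => /le_trans; apply.
  exact: Xmin.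
- move=> [BX LX] Xopt; split=> // Y BY; rewrite penF // mulr0 addr0.
  apply: (le_trans (Xopt Xm (conj BXm LXm))).
  apply: (le_trans (rho1_bound Y BY)); rewrite lerD2l ler_wpM2r //.
  by rewrite (le_trans _ rho_ge) // lerDl.
Qed.

End ExactPenalty.

Theorem theorem2 (R : realType) (n r : nat) (v : 'cV[R]_n)
    (f : 'M[R]_(n, r) -> R) (gamma : R) (S : set 'M[R]_(n, r)) :
  (0 < n)%N -> (0 < r)%N ->
  (sign_points v : set 'M[R]_(n, r)) !=set0 ->
  continuously_differentiable f ->
  0 < gamma ->
  (* S: the global, respectively the local, optimal solutions of (Q) *)
  S = global_minimizers f (Bv v `&` Lambda) \/
  S = local_minimizers f (Bv v `&` Lambda) ->
  (forall Xs, S Xs ->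
     exists L' d' : R, [/\ 0 < L', 0 < d' & growth_at f v Xs L' d']) ->
  (forall Xs (L' d' : R), S Xs ->
     0 < L' -> 0 < d' -> growth_at f v Xs L' d' ->
     exists2 e : R, 0 < e &
       forall X, fball Xs e X -> Bv v X ->
         0 <= f X - f Xs
              + 2 * L' * gamma * (2 * Num.sqrt (n * r)%:R + 1) ^+ 2
                * env gamma (hpen (isqrtn R n)) X)
  /\
  (exists2 rhobar : R, 0 < rhobar &
     forall rho : R, rhobar <= rho ->
       global_minimizers
         (fun X => f X + rho * env gamma (hpen (isqrtn R n)) X) (Bv v)
       = global_minimizers f (Bv v `&` Lambda)).
Proof.
move=> n0 r0 [B Bsign] [fdiff _] g0 Sdef growth.
have fc : continuous f by move=> X; exact: differentiable_continuous.
have SF X : S X -> (Bv v `&` Lambda) X by case: Sdef => -> [].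
(* Global minimizers are also local ones, so in either case the growth hypothesis covers those that
   determine the threshold. *)
have globS X : global_minimizers f (Bv v `&` Lambda) X -> S X.
  case: Sdef => -> // -[FX Xmin]; split=> //.
  by exists 1 => // Y _; exact: Xmin.
split=> [Xs L d /SF FXs|]; first exact: local_exact_penalty.
apply: global_exact_penalty => //.
- by exists (isqrtn R n *: B); exact: sign_point_feasible.
- by move=> Xs /globS; exact: growth.
Qed.
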